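(* In any category, for any phased coproduct $A \mathbin{\dot{+}} B$ of objects $A, B$ (with coprojections $\kappa_A, \kappa_B$) and any object $C$, any phased coproduct $(A \mathbin{\dot{+}} B) \mathbin{\dot{+}} C$ of $A \mathbin{\dot{+}} B$ and $C$ (with coprojections $\kappa_{A \dot{+} B}, \kappa_C$) forms a phased coproduct of $A, B, C$ with coprojections $$\kappa_{A \dot{+} B} \circ \kappa_A, \qquad \kappa_{A \dot{+} B} \circ \kappa_B, \qquad \kappa_C .$$ More generally, any iterated binary phased coproduct $((A_1 \mathbin{\dot{+}} A_2) \mathbin{\dot{+}} \cdots ) \mathbin{\dot{+}} A_n$ forms, with the evident composite coprojections, a phased coproduct of $A_1, \dots, A_n$.
   Context: In any category, a phased coproduct of a family $(A_i)_{i \in J}$ of objects is an object $A$ with morphisms $\kappa_i \colon A_i \to A$ (coprojections) such that: (i) for every family $f_i \colon A_i \to B$ there is $f \colon A \to B$ with $f \circ \kappa_i = f_i$ for all $i$; (ii) any $f, f' \colon A \to B$ with $f \circ \kappa_i = f' \circ \kappa_i$ for all $i$ satisfy $f' = f \circ U$ for some endomorphism $U$ of $A$ with $U \circ \kappa_i = \kappa_i$ for all $i$. A phased coproduct of two objects is written $A \mathbin{\dot{+}} B$. *)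

(* Defs.v *)
From mathcomp Require Import all_boot.

Set Implicit Arguments.
Unset Strict Implicit.
Unset Printing Implicit Defensive.

Record category := Category {
  obj :> Type;
  hom : obj -> obj -> Type;
  idm : forall A : obj, hom A A;
  compm : forall A B D : obj, hom B D -> hom A B -> hom A D;
  compmA : forall (A B D E : obj) (h : hom D E) (g : hom B D) (f : hom A B),
    compm h (compm g f) = compm (compm h g) f;
  comp1m : forall (A B : obj) (f : hom A B), compm (idm B) f = f;
  compm1 : forall (A B : obj) (f : hom A B), compm f (idm A) = f
}.

Arguments hom {c} A B.
Arguments idm {c} A.
Arguments compm {c A B D} g f.

Declare Scope cat_scope.
Delimit Scope cat_scope with cat.
Notation "g ∘ f" := (compm g f) (at level 40, left associativity) : cat_scope.
Open Scope cat_scope.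

Definition is_phased_coproduct (C : category) (J : Type) (A : J -> C) (P : C)
    (kappa : forall i : J, hom (A i) P) : Prop :=
  (forall (B : C) (f : forall i : J, hom (A i) B),
     exists g : hom P B, forall i : J, g ∘ kappa i = f i)
  /\
  (forall (B : C) (f f' : hom P B),
     (forall i : J, f ∘ kappa i = f' ∘ kappa i) ->
     exists U : hom P P,
       (forall i : J, U ∘ kappa i = kappa i) /\ f' = f ∘ U).

Definition family2 (C : category) (A B : C) (i : bool) : C :=
  if i then A else B.

Definition coproj2 (C : category) (A B P : C) (kA : hom A P) (kB : hom B P)
    (i : bool) : hom (family2 A B i) P :=
  match i return hom (family2 A B i) P with
  | true => kA
  | false => kB
  end.

Definition is_phased_coproduct2 (C : category) (A B P : C)
    (kA : hom A P) (kB : hom B P) : Prop :=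
  is_phased_coproduct (coproj2 kA kB).

Variant idx3 : Set := I3_1 | I3_2 | I3_3.

Definition family3 (C : category) (A B D : C) (i : idx3) : C :=
  match i with I3_1 => A | I3_2 => B | I3_3 => D end.

Definition coproj3 (C : category) (A B D P : C)
    (kA : hom A P) (kB : hom B P) (kD : hom D P) (i : idx3) :
    hom (family3 A B D i) P :=
  match i return hom (family3 A B D i) P with
  | I3_1 => kA
  | I3_2 => kB
  | I3_3 => kD
  end.

Definition is_phased_coproduct3 (C : category) (A B D P : C)
    (kA : hom A P) (kB : hom B P) (kD : hom D P) : Prop :=
  is_phased_coproduct (coproj3 kA kB kD).

(* [is_iterated kappa], for A : 'I_n.+1 -> C, says that P is some left-nested
   iterated binary phased coproduct ((A 0 + A 1) + ...) + A n (just A 0 if n = 0), and that kappa is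
   its family of composite coprojections. Every i : 'I_n.+2 is either
   [lift ord_max j], which has the same value as j, or [ord_max], so the two
   equations of [iterated_step] determine kappa without transporting morphisms
   along equalities of indices. *)
Inductive is_iterated (C : category) :
    forall (n : nat) (A : 'I_n.+1 -> C) (P : C),
      (forall i : 'I_n.+1, hom (A i) P) -> Prop :=
| iterated_one (A : 'I_1 -> C)
    (kappa : forall i : 'I_1, hom (A i) (A ord0)) :
    kappa ord0 = idm (A ord0) ->
    is_iterated kappa
| iterated_step (n : nat) (A : 'I_n.+2 -> C) (P Q : C)
    (lambda : forall j : 'I_n.+1, hom (A (lift ord_max j)) P)
    (kP : hom P Q) (kLast : hom (A ord_max) Q)
    (kappa : forall i : 'I_n.+2, hom (A i) Q) :
    is_iterated lambda ->
    is_phased_coproduct2 kP kLast ->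
    (forall j : 'I_n.+1, kappa (lift ord_max j) = kP ∘ lambda j) ->
    kappa ord_max = kLast ->
    is_iterated kappa.

(* Main.v *)
(* Each half of the universal property passes to the left-nested coproduct. For
   the uniqueness half, let f and f' agree on all composite coprojections into
   Q = P + L. The property of P gives f' kP = f kP U with U fixing the
   coprojections of P, and the existence half for Q extends U to V : Q -> Q
   with V kP = kP U and V kL = kL. Then f V and f' agree on kP and kL, so
   f' = f V W with W fixing kP and kL, and V W fixes all composites. *)

Require Import Defs.
From mathcomp Require Import all_boot.

Set Implicit Arguments.
Unset Strict Implicit.
Unset Printing Implicit Defensive.

Section PhasedCoproduct.
Variable C : category.

Lemma phased_coproduct2P (A B P : C) (kA : hom A P) (kB : hom B P) :
  is_phased_coproduct2 kA kB <->
  (forall (X : C) (f : hom A X) (g : hom B X),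
     exists h : hom P X, h ∘ kA = f /\ h ∘ kB = g)
  /\
  (forall (X : C) (f f' : hom P X), f ∘ kA = f' ∘ kA -> f ∘ kB = f' ∘ kB ->
     exists U : hom P P, [/\ U ∘ kA = kA, U ∘ kB = kB & f' = f ∘ U]).
Proof.
split=> -[ex uniq]; split=> X.
- move=> f g; have [h hE] := ex X (coproj2 f g).
  by exists h; split; [exact: hE true | exact: hE false].
- move=> f f' fA fB; have [|U [UE ->]] := uniq X f f'; first by case.
  by exists U; split=> //; [exact: UE true | exact: UE false].
- move=> f; have [h [hA hB]] := ex X (f true) (f false).
  by exists h; case.
- move=> f f' ff'.
  have [U [UA UB ->]] := uniq X f f' (ff' true) (ff' false).
  by exists U; split=> //; case.
Qed.

(** The shared step behind the ternary and the iterated case. Indexing by an abstract [K], covered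
    by the image of [e] and the point [m], lets one argument serve both [idx3] and ordinals. *)
Lemma phased_coproduct_extend (J K : Type) (e : J -> K) (m : K) (A : K -> C)
    (P Q : C) (lambda : forall j, hom (A (e j)) P) (kP : hom P Q)
    (kL : hom (A m) Q) (kappa : forall k, hom (A k) Q) :
  (forall k, (exists j, k = e j) \/ k = m) ->
  is_phased_coproduct lambda -> is_phased_coproduct2 kP kL ->
  (forall j, kappa (e j) = kP ∘ lambda j) -> kappa m = kL ->
  is_phased_coproduct kappa.
Proof.
move=> cover [exP uniqP] /phased_coproduct2P[exQ uniqQ] kappaE kappam.
split=> X.
  move=> f; have [g gE] := exP X (fun j => f (e j)).
  have [h [hP hL]] := exQ X g (f m).
  exists h => k; case: (cover k) => [[j ->]|->]; last by rewrite kappam.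
  by rewrite kappaE compmA hP.
move=> f f' ff'.
have [j|U [UE f'P]] := uniqP X (f ∘ kP) (f' ∘ kP).
  by rewrite -!compmA -kappaE.
have [V [VP VL]] := exQ Q (kP ∘ U) kL.
have [||W [WP WL f'E]] := uniqQ X (f ∘ V) f'.
- by rewrite f'P -!compmA VP.
- by rewrite -compmA VL -kappam.
exists (V ∘ W); split; last by rewrite f'E compmA.
move=> k; case: (cover k) => [[j ->]|->].
  (* Peels off one endomorphism at a time: [W] fixes [kP], then [V] turns [kP] into [kP ∘ U], and
     [U] fixes [lambda j]. *)
  by rewrite kappaE compmA -(compmA V) WP VP -compmA UE.
by rewrite kappam -compmA WL.
Qed.

Lemma phased_coproduct2_assoc (A B D AB ABD : C) (kA : hom A AB)
    (kB : hom B AB) (kAB : hom AB ABD) (kD : hom D ABD) :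
  is_phased_coproduct2 kA kB -> is_phased_coproduct2 kAB kD ->
  is_phased_coproduct3 (kAB ∘ kA) (kAB ∘ kB) kD.
Proof.
move=> /phased_coproduct2P[ex uniq] ABD_coprod.
(* [e] embeds the two indices of the inner coproduct into [idx3], leaving [I3_3] as the added point
   [m]. *)
pose e (b : bool) := if b then I3_1 else I3_2.
pose lambda b : hom (family3 A B D (e b)) AB :=
  match b with true => kA | false => kB end.
apply: (phased_coproduct_extend (e := e) (m := I3_3) (lambda := lambda)
  _ _ ABD_coprod) => //; last by case.
  by case; [left; exists true | left; exists false | right].
(* [family3 A B D (e b)] agrees with [family2 A B b] only after case analysis on [b], so the
   property of [kA], [kB] is rebuilt for [lambda]. *)
split=> X.
  move=> f; have [h [hA hB]] := ex X (f true) (f false).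
  by exists h; case.
move=> f f' ff'.
have [U [UA UB ->]] := uniq X f f' (ff' true) (ff' false).
by exists U; split=> //; case.
Qed.

Lemma phased_coproduct_iterated n (A : 'I_n.+1 -> C) (P : C)
    (kappa : forall i, hom (A i) P) :
  is_iterated kappa -> is_phased_coproduct kappa.
Proof.
elim=> {n A P kappa} [A kappa kappa0 | n A P Q lambda kP kL kappa _ IH PL].
  (* For one object the coprojection is an identity, so agreement on it already forces [f = f'], and
     [U] is the identity. *)
  split=> X.
    by move=> f; exists (f ord0) => i; rewrite (ord1 i) kappa0 compm1.
  move=> f f' /(_ ord0); rewrite kappa0 !compm1 => ->.
  by exists (idm _); split=> [i|]; rewrite ?comp1m ?compm1.
(* Here [e] is [lift ord_max] and [m] is [ord_max]; only the covering condition remains. *)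
apply: phased_coproduct_extend IH PL => i.
by case: (unliftP ord_max i) => [j ->|->]; [left; exists j | right].
Qed.

End PhasedCoproduct.

Theorem proposition2p4 (C : category) :
  (forall (A B D AB ABD : C)
      (kA : hom A AB) (kB : hom B AB) (kAB : hom AB ABD) (kD : hom D ABD),
    is_phased_coproduct2 kA kB ->
    is_phased_coproduct2 kAB kD ->
    is_phased_coproduct3 (kAB ∘ kA) (kAB ∘ kB) kD)
  /\
  (forall (n : nat) (A : 'I_n.+1 -> C) (P : C)
      (kappa : forall i : 'I_n.+1, hom (A i) P),
    is_iterated kappa ->
    is_phased_coproduct kappa).
Proof.
split=> [A B D AB ABD kA kB kAB kD | n A P kappa].
  exact: phased_coproduct2_assoc.
exact: phased_coproduct_iterated.
Qed.
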